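(* Let $G$ and $H$ be graphs and let $x_0,x_1,x_2$ be distinct vertices of $G$ such that $e_1=\overline{x_0x_1}$ and $e_2=\overline{x_1x_2}$ are edges of $G$. Let $\alpha_{ij}:G_{x_ix_j}\to G$, for $(i,j)\in\{(0,1),(1,2)\}$, be the inclusion map of graphs and $\widehat{\alpha}_{ij}:Hom(G,H)\to Hom(G_{x_ix_j},H)$ the associated map of graph complexes. Then the diagram \[ \begin{array}{ccc} Hom(G,H) & \stackrel{=}{\longrightarrow} & Hom(G,H)\\ {\scriptstyle\widehat{\alpha}_{01}}\downarrow & & \downarrow{\scriptstyle\widehat{\alpha}_{12}}\\ Hom(G_{x_0x_1},H) & \stackrel{\mathcal{P}^H(\overrightarrow{e_1e_2})}{\longleftarrow} & Hom(G_{x_1x_2},H) \end{array} \] commutes up to homotopy, i.e. $\mathcal{P}^H(\overrightarrow{e_1e_2})\circ\widehat{\alpha}_{12}\simeq\widehat{\alpha}_{01}$.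
   Context: Graphs are finite, undirected, without loops and multiple edges. For graphs $G,H$, the graph complex $Hom(G,H)\subset\prod_{x\in V(G)}\Delta^{V(H)}$ (where $\Delta^S$ is the simplex with vertex set $S$) is the union of the cells $\prod_{x\in V(G)}\Delta^{\eta(x)}$ over all functions $\eta:V(G)\to 2^{V(H)}\setminus\{\emptyset\}$ such that for every edge $\overline{xy}\in E(G)$ and all $a\in\eta(x)$, $b\in\eta(y)$ one has $\overline{ab}\in E(H)$. A graph homomorphism $f:G\to G'$ induces the continuous map $\widehat f:Hom(G',H)\to Hom(G,H)$, $(p_w)_{w\in V(G')}\mapsto(p_{f(x)})_{x\in V(G)}$, which on cells is $\eta\mapsto\eta\circ f$. For an edge $\overline{xy}$ of $G$, $G_{xy}\cong K_2$ is the subgraph of $G$ consisting of that edge and its two endpoints. The parallel transport $\mathcal{P}^H(\overrightarrow{e_1e_2}):Hom(G_{x_1x_2},H)\to Hom(G_{x_0x_1},H)$ is the map $\widehat{f}$ induced by the isomorphism $f=\overrightarrow{e_1e_2}:G_{x_0x_1}\to G_{x_1x_2}$ (the flip) with $f(x_0)=x_2$, $f(x_1)=x_1$; on cells, $\eta\mapsto\eta'$ with $\eta'(x_0)=\eta(x_2)$, $\eta'(x_1)=\eta(x_1)$. *)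

(* Defs.v *)
From mathcomp Require Import all_boot all_order all_algebra.
From mathcomp Require Import all_classical all_reals all_analysis.

Set Implicit Arguments.
Unset Strict Implicit.
Unset Printing Implicit Defensive.

Import Order.TTheory GRing.Theory Num.Theory.
Import numFieldNormedType.Exports.

Local Open Scope classical_set_scope.
Local Open Scope ring_scope.

Record sgraph := SGraph {
  vertex :> finType;
  adj : rel vertex;
  adj_sym : symmetric adj;
  adj_irr : irreflexive adj }.

Lemma adj_neq (G : sgraph) (x y : G) : adj x y -> x != y.
Proof. by apply: contraTneq => ->; rewrite adj_irr. Qed.

Record ghom (G G' : sgraph) := GHom {
  ghom_fun :> G -> G';
  ghom_adj : forall x y, adj x y -> adj (ghom_fun x) (ghom_fun y) }.

Section EdgeGraph.
Variables (G : sgraph) (x y : G).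

Definition edge_vertex : finType := {z : G | (z == x) || (z == y)}.

Definition edge_adj : rel edge_vertex := fun u v =>
  (sval u == x) && (sval v == y) || (sval u == y) && (sval v == x).

Hypothesis e : adj x y.

Lemma edge_adj_sym : symmetric edge_adj.
Proof. by move=> u v; rewrite /edge_adj orbC andbC [X in _ || X]andbC. Qed.

Lemma edge_adj_irr : irreflexive edge_adj.
Proof.
move=> u; rewrite /edge_adj andbC orbb.
by apply/andP => -[/eqP uy /eqP ux]; have := adj_neq e; rewrite -ux -{2}uy eqxx.
Qed.

(* The subgraph G_xy of G formed by the edge xy and its two endpoints. *)
Definition edge_graph : sgraph := SGraph edge_adj_sym edge_adj_irr.

Lemma edge_incl_adj (u v : edge_graph) : adj u v -> adj (sval u) (sval v).
Proof.
by case/orP=> /andP[/eqP-> /eqP->]; [exact: e | rewrite adj_sym; exact: e].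
Qed.

Definition edge_incl : ghom edge_graph G := GHom edge_incl_adj.

End EdgeGraph.

Section Flip.
Variables (G : sgraph) (x0 x1 x2 : G) (e1 : adj x0 x1) (e2 : adj x1 x2).

Definition flip_val (u : edge_graph e1) : G := if sval u == x0 then x2 else x1.

Lemma flip_subproof u : (flip_val u == x1) || (flip_val u == x2).
Proof. by rewrite /flip_val; case: ifP => _; rewrite eqxx ?orbT. Qed.

Definition flip_fun (u : edge_graph e1) : edge_graph e2 :=
  exist _ (flip_val u) (flip_subproof u).

Lemma flip_adj (u v : edge_graph e1) : adj u v -> adj (flip_fun u) (flip_fun v).
Proof.
have x10 : x1 == x0 = false by rewrite eq_sym; exact/negbTE/adj_neq.
rewrite /adj/= /edge_adj/= /flip_val => /orP[]/andP[/eqP-> /eqP->];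
  by rewrite x10 !eqxx ?orbT.
Qed.

(* The flip G_{x0 x1} -> G_{x1 x2}, with x0 |-> x2 and x1 |-> x1. *)
Definition flip : ghom (edge_graph e1) (edge_graph e2) := GHom flip_adj.

Lemma flip_bij : bijective flip.
Proof.
have x10 : x1 == x0 = false by rewrite eq_sym; exact/negbTE/adj_neq.
have x12 : x1 == x2 = false by exact/negbTE/adj_neq.
have gP (v : edge_graph e2) : let w := if sval v == x2 then x0 else x1 in
    (w == x0) || (w == x1).
  by case: ifP => _ /=; rewrite eqxx ?orbT.
exists (fun v => exist (fun z : G => (z == x0) || (z == x1)) _ (gP v)) => -[z zP]; apply: val_inj => /=.
  rewrite /flip_val/=; case/orP: (zP) => /eqP ->; rewrite ?eqxx ?x10 //.
  by rewrite x12.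
rewrite /flip_val/=; case/orP: (zP) => /eqP ->; rewrite ?eqxx //.
by rewrite x12 x10.
Qed.

End Flip.

Section HomComplex.
Variable R : realType.

(* The face, spanned by A, of the standard simplex on the vertex set S, in
   barycentric coordinates. *)
Definition simplex (S : finType) (A : {set S}) : set {ptws S -> R} :=
  [set p | [/\ forall a, 0 <= p a, \sum_a p a = 1
             & forall a, a \notin A -> p a = 0]].

Definition multihom (G H : sgraph) : set (G -> {set H}) :=
  [set eta | (forall x, eta x != finset.set0) /\
     forall x y, adj x y ->
       forall a b, a \in eta x -> b \in eta y -> adj a b].

Definition cell (G H : sgraph) (eta : G -> {set H}) :
    set {ptws G -> {ptws H -> R}} :=
  [set p | forall x, simplex (eta x) (p x)].

(* As a type, i.e. through the coercion [set_type], this carries the topology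
   induced by the product topology on R^(V(G) x V(H)). *)
Definition HomC (G H : sgraph) : set {ptws G -> {ptws H -> R}} :=
  \bigcup_(eta in @multihom G H) cell eta.
Arguments HomC G H : clear implicits.

Section Induced.
Variables (G G' H : sgraph) (f : ghom G G').

Lemma cell_comp (eta : G' -> {set H}) (p : {ptws G' -> {ptws H -> R}}) :
  cell eta p -> cell (eta \o f : G -> {set H}) (p \o f).
Proof. by move=> etap x; exact: etap. Qed.

Lemma multihom_comp (eta : G' -> {set H}) :
  multihom eta -> multihom (eta \o f : G -> {set H}).
Proof.
by case=> eta0 etaA; split=> [x|x y /(ghom_adj f) fxy a b]; [exact: eta0|
  exact: etaA].
Qed.

Lemma HomC_comp (p : HomC G' H) : (set_val p \o f) \in HomC G H.
Proof.
have [eta etaH etap] := set_valP p; rewrite inE.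
by exists (eta \o f); [exact: multihom_comp | exact: cell_comp].
Qed.

Definition Hom_map (p : HomC G' H) : HomC G H := SigSub (HomC_comp p).

Lemma Hom_map_continuous : continuous Hom_map.
Proof.
have pr x : continuous (fun p : HomC G' H => set_val p (f x) : {ptws H -> R}).
  move=> p; apply: (@continuous_comp _ {ptws G' -> {ptws H -> R}} _ set_val
    (@proj G' (fun=> {ptws H -> R}) (f x))).
    exact: initial_continuous.
  exact: proj_continuous.
apply: (continuous_comp_initial (w := set_val)) => p.
apply/cvg_sup => [|x]; first exact/fmap_filter/nbhs_filter.
move: p; apply: (continuous_comp_initial (w := @^~ x)); exact: pr.
Qed.

End Induced.

End HomComplex.
Arguments HomC R G H : clear implicits.
Arguments Hom_map R {G G'} H f.

(* F is only used on X x [0, 1]; its continuity there forces that of f and g. *)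
Definition homotopic (R : realType) (X Y : topologicalType)
    (f g : X -> Y) :=
  exists F : X * R -> Y,
    [/\ {within setT `*` `[0, 1], continuous F},
        forall x, F (x, 0) = f x & forall x, F (x, 1) = g x].
Arguments homotopic R {X Y} f g.

Definition parallel_transport (R : realType) (G H : sgraph) (x0 x1 x2 : G)
    (e1 : adj x0 x1) (e2 : adj x1 x2) :
    HomC R (edge_graph e2) H -> HomC R (edge_graph e1) H :=
  Hom_map R H (flip e1 e2).
Arguments parallel_transport R {G} H {x0 x1 x2} e1 e2.

(* Main.v *)
(* Line-segment homotopy: if adjacent vertices x, y of G always have adjacent
   images f x, g y, then the points p \o f and p \o g, for p in the cell of
   eta, both lie in the cell of x |-> eta (f x) :|: eta (g x), which is convex.
   This applies to f = alpha_12 \o flip and g = alpha_01, which agree at x1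
   and send x0 to x2 and x0, both neighbours of x1. *)
Require Import Defs.
From mathcomp Require Import all_boot all_order all_algebra.
From mathcomp Require Import all_classical all_reals all_analysis.
Import numFieldNormedType.Exports.

Set Implicit Arguments.
Unset Strict Implicit.
Unset Printing Implicit Defensive.

Import Order.TTheory GRing.Theory Num.Theory.

Local Open Scope classical_set_scope.
Local Open Scope ring_scope.

Lemma ghom_comp_adj (G1 G2 G3 : sgraph) (g : ghom G2 G3) (f : ghom G1 G2) x y :
  adj x y -> adj ((g \o f) x) ((g \o f) y).
Proof. by move=> /(ghom_adj f) /(ghom_adj g). Qed.

Definition ghom_comp (G1 G2 G3 : sgraph) (g : ghom G2 G3) (f : ghom G1 G2) :=
  GHom (ghom_comp_adj g f).

Section Clamp.
Variable R : realType.

Definition clamp01 (t : R) : R := Num.max 0 (Num.min 1 t).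

Lemma clamp01_ge0 t : 0 <= clamp01 t.
Proof. by rewrite le_max lexx. Qed.

Lemma clamp01_le1 t : clamp01 t <= 1.
Proof. by rewrite ge_max ler01 ge_min lexx. Qed.

Lemma clamp01_0 : clamp01 0 = 0.
Proof. by rewrite /clamp01 min_r ?ler01 // maxxx. Qed.

Lemma clamp01_1 : clamp01 1 = 1.
Proof. by rewrite /clamp01 minxx max_r ?ler01. Qed.

Lemma continuous_clamp01 : continuous clamp01.
Proof.
move=> t; apply: (@continuous_max _ _ (cst 0)); first exact: cvg_cst.
by apply: (@continuous_min _ _ (cst 1)); [exact: cvg_cst | exact: cvg_id].
Qed.

End Clamp.

Lemma simplex_subset (R : realType) (S : finType) (A B : {set S}) :
  A \subset B -> @simplex R S A `<=` simplex B.
Proof.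
move=> AB p [p0 p1 pA]; split=> // a aB; apply: pA.
by apply: contra aB; exact/fintype.subsetP.
Qed.

Lemma simplex_convex (R : realType) (S : finType) (A : {set S}) (t : R)
    (p q : {ptws S -> R}) : 0 <= t <= 1 -> simplex A p -> simplex A q ->
  simplex A (fun a => (1 - t) * p a + t * q a : R).
Proof.
move=> /andP[t0 t1] [p0 p1 pA] [q0 q1 qA]; split=> [a||a aA].
- by rewrite addr_ge0 // mulr_ge0 // subr_ge0.
- by rewrite big_split/= -!mulr_sumr p1 q1 !mulr1 subrK.
- by rewrite pA // qA // !mulr0 addr0.
Qed.

Section HomCTopology.
Variables (R : realType) (G H : sgraph).

Lemma HomC_coord_continuous (x : G) (a : H) :
  continuous (fun p : HomC R G H => set_val p x a : R).
Proof.
have cx : continuous (fun p : HomC R G H => set_val p x : {ptws H -> R}).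
  move=> p; apply: (@continuous_comp _ {ptws G -> {ptws H -> R}} _ set_val
    (@proj G (fun=> {ptws H -> R}) x)).
    exact: initial_continuous.
  exact: proj_continuous.
move=> p; apply: (@continuous_comp _ {ptws H -> R} _
    (fun p : HomC R G H => set_val p x : {ptws H -> R})
    (@proj H (fun=> R : topologicalType) a)).
  exact: cx.
exact: proj_continuous.
Qed.

(** The topology of the complex is initial three times over: for the inclusion into the product, for
    evaluation at a vertex [x] of [G], and for the barycentric coordinate at [a]. Real-valued
    coordinates therefore detect continuity. *)
Lemma HomC_continuous (T : topologicalType) (F : T -> HomC R G H) :
  (forall x a, continuous (fun t => set_val (F t) x a : R)) -> continuous F.
Proof.
move=> cF; apply: (continuous_comp_initial (w := set_val)) => t.
apply/cvg_sup => x.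
move: t; apply: (continuous_comp_initial (w := @^~ x)) => t.
apply/cvg_sup => a.
by move: t; apply: (continuous_comp_initial (w := @^~ a)); exact: cF.
Qed.

End HomCTopology.

Section TimesHomotopy.
Variables (R : realType) (G G' H : sgraph) (f g : ghom G G').
Hypothesis fg_adj : forall x y, adj x y -> adj (f x) (g y).

Lemma multihomU (eta : G' -> {set H}) : multihom eta ->
  multihom (fun x => eta (f x) :|: eta (g x))%SET.
Proof.
move=> [eta0 etaA]; split=> [x|x y xy a b].
  by rewrite finset.setU_eq0 negb_and eta0.
rewrite !finset.inE => /orP[] ax /orP[] by_.
- exact: etaA (ghom_adj f xy) _ _ ax by_.
- exact: etaA (fg_adj xy) _ _ ax by_.
(* [fg_adj] relates [f] to [g] in that order only, so the edge is reversed in both [G'] and [G]. *)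
- apply: etaA ax by_; rewrite adj_sym; by apply: fg_adj; rewrite adj_sym.
- exact: etaA (ghom_adj g xy) _ _ ax by_.
Qed.

(* [homotopic] asks for a function on all of R: the clamped time keeps the
   segment inside the complex for every real time. *)
Definition segment_val (z : HomC R G' H * R) : {ptws G -> {ptws H -> R}} :=
  fun x a => (1 - clamp01 z.2) * set_val z.1 (f x) a
             + clamp01 z.2 * set_val z.1 (g x) a.

Lemma segment_subproof z : segment_val z \in HomC R G H.
Proof.
have [eta etaH etap] := set_valP z.1; rewrite inE.
exists (fun x => eta (f x) :|: eta (g x))%SET; first exact: multihomU.
move=> x; apply: simplex_convex; first by rewrite clamp01_ge0 clamp01_le1.
- exact: (simplex_subset (finset.subsetUl _ _)).
- exact: (simplex_subset (finset.subsetUr _ _)).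
Qed.

Definition segment z : HomC R G H := SigSub (segment_subproof z).

(** Each coordinate is a polynomial in the clamped time and two coordinates of the point, all
    jointly continuous on the product. *)
Lemma segment_continuous : continuous segment.
Proof.
apply: HomC_continuous => x a z; rewrite /continuous_at /= /segment_val.
have cc : {for z, continuous (fun z : HomC R G' H * R => clamp01 z.2)}.
  by apply: (@continuous_comp _ _ _ snd);
    [exact: cvg_snd | exact: continuous_clamp01].
have cp y : {for z, continuous
    (fun z : HomC R G' H * R => set_val z.1 y a : R)}.
  apply: (@continuous_comp _ (HomC R G' H) R fst
    (fun p : HomC R G' H => set_val p y a : R)); first exact: cvg_fst.
  exact: HomC_coord_continuous.
apply: (@cvgD _ R^o); apply: cvgM; [|exact: cp|exact: cc|exact: cp].
by apply: (@cvgB _ R^o); [exact: cvg_cst|exact: cc].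
Qed.

(** Together, [f], [g] and [fg_adj] amount to a homomorphism to [G'] from the categorical product of
    [G] with a looped edge, that is, a one-step times-homotopy. *)
Lemma Hom_map_homotopic : homotopic R (Hom_map R H f) (Hom_map R H g).
Proof.
exists segment; split=> [|p|p].
- exact/continuous_subspaceT/segment_continuous.
- apply: val_inj; apply/funext => x; apply/funext => a /=.
  by rewrite /segment_val/= clamp01_0 subr0 mul1r mul0r addr0.
- apply: val_inj; apply/funext => x; apply/funext => a /=.
  by rewrite /segment_val/= clamp01_1 subrr mul1r mul0r add0r.
Qed.

End TimesHomotopy.

Lemma Hom_map_comp (R : realType) (G1 G2 G3 H : sgraph) (g : ghom G2 G3)
    (f : ghom G1 G2) :
  Hom_map R H (ghom_comp g f) = Hom_map R H f \o Hom_map R H g.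
Proof. by apply/funext => p; exact: val_inj. Qed.

(** The ordered edge [(x0, x1)] goes to [(x2, x1)], an edge by [e2]; the reversed one [(x1, x0)]
    goes to itself, an edge by [e1]. *)
Lemma flip_incl_adj (G : sgraph) (x0 x1 x2 : G) (e1 : adj x0 x1)
    (e2 : adj x1 x2) (u v : edge_graph e1) : adj u v ->
  adj (ghom_comp (edge_incl e2) (flip e1 e2) u) (edge_incl e1 v).
Proof.
rewrite /= /flip_val => /orP[]/andP[/eqP-> /eqP->].
  by rewrite eqxx adj_sym.
by rewrite eq_sym (negbTE (adj_neq e1)) adj_sym.
Qed.

Local Close Scope ring_scope.
Local Close Scope classical_set_scope.

Theorem proposition4p3 (R : realType) (G H : sgraph) (x0 x1 x2 : G)
    (x01 : x0 != x1) (x02 : x0 != x2) (x12 : x1 != x2)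
    (e1 : adj x0 x1) (e2 : adj x1 x2) :
  homotopic R
    (parallel_transport R H e1 e2 \o Hom_map R H (edge_incl e2))
    (Hom_map R H (edge_incl e1)).
Proof.
(* By contravariance, the composite is the map induced by the flip followed by the inclusion of the
   second edge. *)
rewrite /parallel_transport -Hom_map_comp.
by apply: Hom_map_homotopic; exact: flip_incl_adj.
Qed.
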